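(* Let $\kappa$ be a compact subset of $\mathbb{R}^d$ and let $\mathcal{P}_\kappa$ be a finite dimensional subspace of $\mathcal{C}^0(\kappa,\mathbb{R})$ that contains the constant function $1_\kappa$. Suppose that there exists a quadrature $(\varpi_i^\kappa,\mathbf{y}_i^\kappa)_{1\le i\le N_v}$ with positive weights $\varpi_i^\kappa>0$ and points $\mathbf{y}_i^\kappa\in\kappa$ that integrates exactly products of functions in $\mathcal{P}_\kappa$: $$\int_\kappa f(\mathbf{y})g(\mathbf{y})\,dV=\sum_{i=1}^{N_v}\varpi_i^\kappa f(\mathbf{y}_i^\kappa)g(\mathbf{y}_i^\kappa)\qquad\forall f,g\in\mathcal{P}_\kappa.$$ Then, for given points $(\mathbf{x}_i^\kappa)_{1\le i\le N_f}$ in $\kappa$, there exist nonnegative coefficients $(\nu_i^\kappa)_{1\le i\le N_v}$ and positive coefficients $(\beta_i^\kappa)_{1\le i\le N_f}$ such that $$\langle f\rangle_\kappa=\sum_{i=1}^{N_v}\nu_i^\kappa f(\mathbf{y}_i^\kappa)+\sum_{i=1}^{N_f}\beta_i^\kappa f(\mathbf{x}_i^\kappa)\qquad\forall f\in\mathcal{P}_\kappa.$$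
   Context: $\mathcal{C}^0(\kappa,\mathbb{R})$ is the space of continuous real-valued functions on $\kappa$, and $\langle f\rangle_\kappa=\frac{1}{|\kappa|}\int_\kappa f\,dV$ denotes the average of $f$ over $\kappa$, where $|\kappa|$ is the volume of $\kappa$.
   Formalization: Added assumption: every nonempty relatively open subset of κ has positive volume; without it the claim fails, e.g. κ = [0,1] ∪ {2}, P_κ spanned by 1 and the indicator of {2}, one quadrature point y = 1/2 with weight 1, and x = 2. *)

(* Defs.v *)
From HB Require Import structures.
From mathcomp Require Import all_boot all_order all_algebra.
From mathcomp Require Import all_classical all_reals all_analysis.
From mathcomp Require Import measurable_realfun.

Set Implicit Arguments.
Unset Strict Implicit.
Unset Printing Implicit Defensive.

Import Order.TTheory GRing.Theory Num.Theory.
Import numFieldNormedType.Exports.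

Local Open Scope classical_set_scope.
Local Open Scope ring_scope.

(* The n-dimensional Lebesgue measure is the n-fold product of the
   one-dimensional one, first on the product sigma-algebra of n.-tuple, then
   transported to the Borel sigma-algebra of 'rV[R]_n; lebesgue_rV_box gives the
   characteristic value on boxes. *)
Section lebesgue_tuple.
Context (R : realType).
Local Notation T := (measurableTypeR R).

Definition tuple_cons n (p : T * n.-tuple T) : n.+1.-tuple T :=
  [tuple of p.1 :: p.2].

Lemma measurable_tuple_cons n : measurable_fun [set: _] (@tuple_cons n).
Proof. by apply: measurable_cons. Qed.

Section step.
Context n (m : {sigma_finite_measure set (n.-tuple T) -> \bar R}).

Definition lebesgue_step : set (n.+1.-tuple T) -> \bar R :=
  pushforward (@lebesgue_measure R \x m)%E (@tuple_cons n).

HB.instance Definition _ := Measure.copy lebesgue_step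
  (measure_function_pushforward__canonical__measure_function_Measure
    (@lebesgue_measure R \x m)%E (@measurable_tuple_cons n)).

Lemma lebesgue_step_sigma_finite : sigma_finite [set: _] lebesgue_step.
Proof.
have /sigma_finiteP[F [FT ndF mF]] := sigma_finiteT (@lebesgue_measure R).
have /sigma_finiteP[G [GT ndG mG]] := sigma_finiteT m.
pose uncons (t : n.+1.-tuple T) : T * n.-tuple T :=
  (tnth t ord0, [tuple of behead t]).
have consK : cancel (@tuple_cons n) uncons.
  by move=> [x t]; congr pair; apply: val_inj.
have muncons : measurable_fun setT uncons.
  apply/measurable_fun_pairP; split; first exact: measurable_tnth.
  exact: measurable_behead.
exists (fun i => uncons @^-1` (F i `*` G i)).
  apply/seteqP; split=> // t _.
  have : [set: T] (tnth t ord0) by [].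
  have : [set: n.-tuple T] [tuple of behead t] by [].
  rewrite FT GT => -[k _ Gk] [l _ Fl]; exists (maxn l k) => //; split => /=.
  - by move: Fl; apply/subsetPset/ndF/leq_maxl.
  - by move: Gk; apply/subsetPset/ndG/leq_maxr.
move=> i; have [mFi Foo] := mF i; have [mGi Goo] := mG i; split.
  rewrite -[X in measurable X]setTI; apply: muncons => //.
  exact: measurableX.
rewrite /lebesgue_step /pushforward -comp_preimage.
rewrite (_ : uncons \o _ = id); last exact/funext.
rewrite preimage_id product_measure1E//.
by rewrite lte_mul_pinfty// ge0_fin_numE.
Qed.

HB.instance Definition _ := Measure_isSigmaFinite.Build _ _ _ lebesgue_step
  lebesgue_step_sigma_finite.

End step.

Fixpoint lebesgue_tuple n : {sigma_finite_measure set (n.-tuple T) -> \bar R} :=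
  match n with
  | 0 => \d_ [tuple]
  | n.+1 => lebesgue_step (lebesgue_tuple n)
  end.

Lemma lebesgue_tuple_box n (a b : 'I_n -> R) : (forall i, a i <= b i) ->
  lebesgue_tuple n [set t | forall i, a i <= tnth t i <= b i] =
  (\prod_(i < n) (b i - a i))%:E.
Proof.
elim: n a b => [|n IH] a b ab.
  rewrite big_ord0 /= diracE (_ : _ \in _ = true)//.
  by apply/mem_set => -[].
rewrite big_ord_recl EFinM.
rewrite -[X in (_ * X)%E](IH (a \o lift ord0) (b \o lift ord0))//=.
rewrite /lebesgue_step /pushforward.
rewrite (_ : _ @^-1` _ = `[a ord0, b ord0]%classic `*`
  [set t | forall i, a (lift ord0 i) <= tnth t i <= b (lift ord0 i)]).
  rewrite product_measure1E//=.
    rewrite lebesgue_measure_itv/= lte_fin; case: ltP => //.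
    move=> ba; have -> : a ord0 = b ord0 by apply: le_anti; rewrite ab.
    by rewrite subrr.
  rewrite (_ : [set _ | _] = \bigcap_(i in [set: 'I_n])
     ((fun t : n.-tuple T => tnth t i) @^-1` `[a (lift ord0 i), b (lift ord0 i)])).
    apply: fin_bigcap_measurable => // i _; rewrite -[X in measurable X]setTI.
    by apply: measurable_tnth.
  by apply/seteqP; split=> [t H i _ /=|t H i]; have := H i; rewrite /= in_itv; apply.
apply/seteqP; split=> [[x t] H|[x t] [/= xab H] i].
  split; first by have := H ord0; rewrite /= in_itv.
  by move=> i /=; have := H (lift ord0 i); rewrite (tnthS x).
case: (unliftP ord0 i) => [j ->|->]; first by rewrite (tnthS x).
by move: xab; rewrite in_itv.
Qed.

End lebesgue_tuple.

Section lebesgue_rV.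
Context (R : realType) (d : nat).

Definition borel_rV := g_sigma_algebraType (@open 'rV[R]_d).

Definition row_of_tuple (t : d.-tuple (measurableTypeR R)) : borel_rV :=
  \row_i tnth t i.

Lemma measurable_row_of_tuple : measurable_fun [set: _] row_of_tuple.
Proof.
apply: (@measurability _ _ _ borel_rV setT row_of_tuple (@open 'rV[R]_d)) => //.
move=> _ [U oU <-]; rewrite setTI.
have rE (t : d.-tuple R) i : (row_of_tuple t : 'rV[R]_d) ord0 i = tnth t i.
  by rewrite mxE.
pose I := ('rV[rat]_d * nat)%type.
pose c (p : I) : 'rV[R]_d := map_mx ratr p.1.
pose F (p : I) := if `[< ball (c p) p.2.+1%:R^-1 `<=` U >]
  then row_of_tuple @^-1` (ball (c p) p.2.+1%:R^-1 : set 'rV[R]_d) else set0.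
rewrite (_ : _ @^-1` _ = \bigcup_p F p).
  apply: countable_bigcupT_measurable; first exact: countableP.
  move=> -[q k]; rewrite /F; case: ifPn => // _.
  rewrite (_ : _ @^-1` _ = \bigcap_(i in [set: 'I_d])
     ((fun t : d.-tuple (measurableTypeR R) => tnth t i) @^-1` ball (c (q, k) ord0 i) k.+1%:R^-1)).
    apply: fin_bigcap_measurable => // i _; rewrite -[X in measurable X]setTI.
    apply: measurable_tnth => //.
    by apply: open_measurable; apply: ball_open.
  apply/seteqP; split=> [t [_ H] i _|t H] /=.
    by have := H ord0 i; rewrite rE.
  by split=> // j i; rewrite ord1 rE; exact: H.
apply/seteqP; split=> [t Ut|t [p _]]; last first.
  by rewrite /F; case: asboolP => // + tp; apply.
have /nbhs_ballP[e /= e0 eU] : nbhs (row_of_tuple t : 'rV[R]_d) U.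
  exact: open_nbhs_nbhs.
have [k ke] : exists k : nat, k.+1%:R^-1 < e / 2.
  have [N] := @reals.ltr_add_invr R 0 (e / 2) ltac:(by rewrite divr_gt0).
  by rewrite add0r; exists N.
have kp : (0 : R) < k.+1%:R^-1 by rewrite invr_gt0.
have /choice[q Hq] : forall i, exists q : rat, `|ratr q - tnth t i| < k.+1%:R^-1.
  move=> i; have [q] := @rat_in_itvoo R (tnth t i - k.+1%:R^-1) (tnth t i + k.+1%:R^-1)
     ltac:(by rewrite ltrD2l gtrN).
  by rewrite in_itv/= => /andP[h1 h2]; exists q; rewrite ltr_distl h1.
exists (\row_i q i, k) => //; rewrite /F.
have tb : ball (c (\row_i q i, k)) k.+1%:R^-1 (row_of_tuple t : 'rV[R]_d).
  by split=> // i j; rewrite !mxE; exact: Hq.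
rewrite asboolT// => v vb; apply: eU.
apply: (@le_ball _ _ _ (k.+1%:R^-1 + k.+1%:R^-1)); first by rewrite [leRHS]splitr lerD ?ltW.
by apply: ball_triangle vb; apply: ball_sym.
Qed.

Definition lebesgue_rV : set borel_rV -> \bar R :=
  pushforward (lebesgue_tuple R d) row_of_tuple.

HB.instance Definition _ := Measure.copy lebesgue_rV
  (measure_function_pushforward__canonical__measure_function_Measure
    (lebesgue_tuple R d) measurable_row_of_tuple).

Lemma lebesgue_rV_box (a b : 'rV[R]_d) : (forall i, a ord0 i <= b ord0 i) ->
  lebesgue_rV [set v | forall i, a ord0 i <= (v : 'rV_d) ord0 i <= b ord0 i] =
  (\prod_(i < d) (b ord0 i - a ord0 i))%:E.
Proof.
move=> ab; rewrite -(lebesgue_tuple_box ab) /lebesgue_rV /pushforward.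
by congr (lebesgue_tuple R d _); apply/seteqP; split=> t /= H i; have := H i; rewrite mxE.
Qed.

End lebesgue_rV.

Arguments lebesgue_rV : clear implicits.

Definition span_of (R : realType) (V : lmodType R) n (b : 'I_n -> V) : set V :=
  [set \sum_i c i *: b i | c in [set: 'I_n -> R]].

Definition finite_dimensional (R : realType) (V : lmodType R) (P : set V) :=
  exists n (b : 'I_n -> V), P = span_of b.

Section integration_on_compact.
Context (R : realType) (d : nat) (K : set 'rV[R]_d).

(* f lives on the subtype K; the value 0 of its extension outside K does not
   matter, since the integral is restricted to K. *)
Definition integral_on (f : K -> R) : R :=
  \int[lebesgue_rV R d]_(x in K) ('valL_ 0 f) x.

Definition average (f : K -> R) : R :=
  (fine (lebesgue_rV R d K))^-1 * integral_on f.

(* K is the support of its own volume measure. This holds for instance when K is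
   the closure of its interior, and gives K positive volume as soon as K is
   nonempty. It is what makes (f, g) |-> integral_on (f \* g) definite on
   continuous functions: it fails for K = [0, 1] `|` {2}, where the indicator of
   {2} is continuous, nonzero and has integral 0. *)
Definition full_lebesgue_support :=
  forall U : set 'rV[R]_d, open U -> U `&` K !=set0 ->
    (0 < lebesgue_rV R d (U `&` K))%E.

End integration_on_compact.

(* Main.v *)
Require Import Defs.
From HB Require Import structures.
From mathcomp Require Import all_boot all_order all_algebra.
From mathcomp Require Import all_classical all_reals all_analysis.
From mathcomp Require Import measurable_realfun.

(** Since kappa carries its volume measure with full support, a function of P
   vanishing at all y i has [\int f^2 = 0], hence is zero: f in P is determined
   by its values at the points y i, so each evaluation at a point x j is a linear
   combination, with coefficients a i j, of the evaluations at the y i. The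
   weights w i / |kappa| being positive, a small positive multiple of
   [f (x j) - \sum_i a i j * f (y i) = 0] can be added to the quadrature formula
   for the average without making the coefficients at the y i negative. *)

Set Implicit Arguments.
Unset Strict Implicit.
Unset Printing Implicit Defensive.

Import Order.TTheory GRing.Theory Num.Theory.
Import numFieldNormedType.Exports.

Local Open Scope classical_set_scope.
Local Open Scope ring_scope.

(** After transposition, row space inclusion is tested by multiplying with the cokernel of [B^T],
    and the rows of the transposed cokernel lie in the left kernel of [B]. *)
Lemma mulmx_solvable (F : fieldType) m n p (B : 'M[F]_(m, n)) (C : 'M[F]_(m, p)) :
  (forall u : 'rV[F]_m, u *m B = 0 -> u *m C = 0) -> exists A, B *m A = C.
Proof.
move=> BC; suff /submxP[D CD] : (C^T <= B^T)%MS.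
  by exists D^T; apply: trmx_inj; rewrite trmx_mul trmxK.
rewrite submxE -[_ *m _]trmxK trmx_mul trmxK -trmx0; apply/eqP; congr trmx.
apply/row_matrixP => i; rewrite row_mul row0; apply: BC.
rewrite -row_mul (_ : _ *m B = 0) ?row0//.
by apply: trmx_inj; rewrite trmx_mul trmxK mulmx_coker trmx0.
Qed.

Section lebesgue_rV_compact.
Context (R : realType) (d : nat).
Implicit Types K : set 'rV[R]_d.

Lemma open_borel_rV (U : set 'rV[R]_d) :
  open U -> measurable (U : set (borel_rV R d)).
Proof. exact: sub_sigma_algebra. Qed.

Lemma closed_borel_rV K : closed K -> measurable (K : set (borel_rV R d)).
Proof.
by move=> /closed_openC /open_borel_rV /measurableC; rewrite setCK.
Qed.

Lemma compact_borel_rV K : compact K -> measurable (K : set (borel_rV R d)).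
Proof. by move=> /(compact_closed (@norm_hausdorff _ _)) /closed_borel_rV. Qed.

(** The norm on ['rV[R]_d] is the maximum norm, so a bounded set lies in a cube, whose volume is
    known. *)
Lemma lebesgue_rV_compact_lty K : compact K -> (lebesgue_rV R d K < +oo)%E.
Proof.
move=> cK; have [M [_ KM]] := compact_bounded cK.
(* Boundedness only bounds norms by numbers strictly above [M]; the absolute value makes [N]
   nonnegative, which orders the sides of the cube. *)
pose N := `|M| + 1; have N0 : 0 <= N by rewrite addr_ge0.
have {}KM v : K v -> `|v| <= N by apply: KM; rewrite ltr_pwDr// ler_norm.
pose box := [set v : 'rV[R]_d | forall i,
  (const_mx (- N) : 'rV[R]_d) ord0 i <= v ord0 i <= (const_mx N : 'rV[R]_d) ord0 i].
have Kbox : K `<=` box.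
  move=> v /KM vN i; rewrite !mxE -ler_norml; apply: le_trans vN.
  by rewrite [leRHS]/Num.norm /= mx_normrE; apply/bigmax_geP; right => /=; exists (ord0, i).
have mbox : measurable (box : set (borel_rV R d)).
  apply: compact_borel_rV; rewrite (_ : box = [set v | forall i, v ord0 i \in `[- N, N]]).
    apply: (@rV_compact _ _ (fun=> `[- N, N]%classic)) => _.
    exact: segment_compact.
  by apply/seteqP; split=> v H i; move: (H i); rewrite /= in_itv/= !mxE.
apply: (@le_lt_trans _ _ (lebesgue_rV R d box)).
  by apply: le_measure => //; rewrite inE//; exact: compact_borel_rV.
by rewrite lebesgue_rV_box ?ltry// => i; rewrite !mxE ge0_cp.
Qed.

(** Open intervals generate the Borel sets of [R], and their preimages in [K] are traces on [K] of
    open sets. *)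
Lemma within_continuous_measurable_rV K (f : 'rV[R]_d -> R) :
  measurable (K : set (borel_rV R d)) -> {within K, continuous f} ->
  measurable_fun (K : set (borel_rV R d)) f.
Proof.
move=> mK /continuousP cf; apply: (measurability _ (RGenOpens.measurableE R)).
move=> _ [_ [a [b ->] <-]].
have /open_subspaceP[V oV VD] := cf _ (interval_open (a := BRight a) (b := BLeft b) isT isT).
by rewrite setIC -VD; apply: measurableI => //; exact: open_borel_rV.
Qed.

End lebesgue_rV_compact.

Section integral_on_compact.
Context (R : realType) (d : nat) (K : set 'rV[R]_d)
  (cK : compact K) (sK : full_lebesgue_support K).

Lemma integrable_valL (f : K -> R) : continuous f ->
  (lebesgue_rV R d).-integrable K (EFin \o 'valL_ 0 f).
Proof.
move=> /(subspace_valL_continuousP' _ 0) cf.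
have mK := compact_borel_rV cK.
apply: measurable_bounded_integrable => //.
- exact: lebesgue_rV_compact_lty.
- exact: within_continuous_measurable_rV.
have /compact_bounded[M [_ Mf]] := continuous_compact cf cK.
by exists M; split; rewrite ?num_real// => N MN v Kv; apply: (Mf N MN); exists v.
Qed.

(** By continuity [f] exceeds [f z / 2] on a relatively open neighbourhood of [z] in [K], which has
    positive volume by full support. *)
Lemma integral_on_gt0 (f : K -> R) z : continuous f -> (forall v, 0 <= f v) ->
  0 < f z -> 0 < integral_on f.
Proof.
move=> cf f0 fz; set g := 'valL_ 0 f.
have gE (v : K) : g (set_val v) = f v by rewrite -[RHS](congr1 (@^~ v) (valLK 0 f)).
have g0 v : K v -> 0 <= g v.
  by move=> Kv; have := f0 (SigSub (mem_set Kv)); rewrite -gE.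
have intg := integrable_valL cf.
have mg := measurable_int _ intg.
have mK := compact_borel_rV cK.
have /continuousP cg : {within K, continuous g}.
  exact/(subspace_valL_continuousP' _ 0).
pose e := f z / 2; have e0 : 0 < e by rewrite divr_gt0.
have /open_subspaceP[U oU UK] := cg _ (@open_gt R e).
have mUK : measurable (U `&` K : set (borel_rV R d)).
  by apply: measurableI => //; exact: open_borel_rV.
have UKe v : (U `&` K) v -> e <= g v.
  by rewrite UK => -[/= /ltW].
have UKz : U `&` K !=set0.
  exists (set_val z); rewrite UK; split; last exact: set_valP.
  suff : e < g (set_val z) by [].
  by rewrite gE /e ltr_pdivrMr// mulr_natr mulr2n ltrDl.
rewrite -lte_fin /integral_on /Rintegral fineK; last exact: integrable_fin_num.
apply: (@lt_le_trans _ _ (\int[lebesgue_rV R d]_(x in U `&` K) cst e%:E x)%E).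
  by rewrite integral_cst// mule_gt0 ?lte_fin//; exact: sK.
apply: (@le_trans _ _ (\int[lebesgue_rV R d]_(x in U `&` K) (g x)%:E)%E).
  apply: ge0_le_integral => //.
  - by move=> x _; rewrite lee_fin ltW.
  - by apply: measurable_funS mg => //; exact: subIsetr.
exact: ge0_subset_integral.
Qed.

Lemma integral_on_sqr_eq0 (f : K -> R) : continuous f ->
  integral_on (f \* f) = 0 -> f = cst 0.
Proof.
move=> cf If; apply/funext => z; apply: contra_eq If => fz /=.
apply/lt0r_neq0/(@integral_on_gt0 _ z).
- by move=> v; exact: (cvgM (cf v) (cf v)).
- by move=> v; rewrite /= -expr2 sqr_ge0.
- by rewrite /= -expr2 exprn_even_gt0.
Qed.

End integral_on_compact.

Theorem lemma3p1 (R : realType) (d : nat) (kappa : set 'rV[R]_d)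
  (P : set (kappa -> R))
  (kappa_compact : compact kappa)
  (kappa_support : full_lebesgue_support kappa)
  (P_continuous : P `<=` [set f | continuous f])
  (P_submod : submod_closed [in P])
  (P_findim : finite_dimensional P)
  (P_one : P (cst 1))
  (Nv : nat) (w : 'I_Nv -> R) (y : 'I_Nv -> kappa)
  (w_gt0 : forall i, 0 < w i)
  (quadrature : forall f g, P f -> P g ->
     integral_on (f \* g) = \sum_(i < Nv) w i * (f (y i) * g (y i)))
  (Nf : nat) (x : 'I_Nf -> kappa) :
  exists (nu : 'I_Nv -> R) (beta : 'I_Nf -> R),
    [/\ forall i, 0 <= nu i,
        forall i, 0 < beta i &
        forall f, P f ->
          average f = \sum_(i < Nv) nu i * f (y i)
                    + \sum_(i < Nf) beta i * f (x i)].
Proof.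
have [n [b Pb]] := P_findim.
have Pspan c : P (\sum_i c i *: b i) by rewrite Pb; exists c.
have spanE (c : 'I_n -> R) v : (\sum_i c i *: b i) v = \sum_i c i * b i v.
  by rewrite fct_sumE.
have P_eq0 f : P f -> (forall i, f (y i) = 0) -> f = cst 0.
  move=> Pf fy; apply: (integral_on_sqr_eq0 kappa_compact kappa_support).
    exact: P_continuous.
  by rewrite quadrature// big1// => i _; rewrite fy mul0r mulr0.
pose B := \matrix_(k < n, i < Nv) b k (y i).
pose C := \matrix_(k < n, j < Nf) b k (x j).
(* A row [u] with [u *m B = 0] lists the coefficients of a function in [P] that vanishes at every
   [y i]; this function is zero, so its values at the [x j] vanish too. *)
have [u uB|A BA] := @mulmx_solvable _ _ _ _ B C.
  have u0 : \sum_i u ord0 i *: b i = cst 0.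
    apply: P_eq0 => // i; rewrite spanE.
    move/rowP/(_ i): uB; rewrite !mxE => uBi; rewrite -[RHS]uBi.
    by apply: eq_bigr => k _; rewrite !mxE.
  apply/rowP => j; rewrite !mxE -[RHS](congr1 (@^~ (x j)) u0) spanE.
  by apply: eq_bigr => k _; rewrite !mxE.
have fxE f j : P f -> f (x j) = \sum_i A i j * f (y i).
  rewrite Pb => -[c _ <-]; rewrite spanE.
  under [RHS]eq_bigr do rewrite spanE mulr_sumr.
  rewrite exchange_big /=; apply: eq_bigr => k _.
  move/matrixP/(_ k j): BA; rewrite !mxE => <-; rewrite mulr_sumr.
  by apply: eq_bigr => i _; rewrite !mxE [RHS]mulrCA [A i j * _]mulrC.
set V := fine (lebesgue_rV R d kappa).
(* The quadrature is exact for products, so it applies to [f] times the constant 1. *)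
have averageE f : P f -> average f = \sum_i w i / V * f (y i).
  move=> Pf; rewrite /average (_ : f = f \* cst 1); last first.
    by apply/funext => v; rewrite /= mulr1.
  rewrite quadrature// mulr_sumr; apply: eq_bigr => i _ /=.
  by rewrite mulr1 mulrA [_^-1 * _]mulrC.
(* As [kappa] may be empty, positivity needs a point; where it is used below, some [y i] provides
   one. *)
have V_gt0 (v : kappa) : 0 < V.
  apply: fine_gt0; rewrite lebesgue_rV_compact_lty// andbT.
  rewrite -[kappa]setTI; apply: kappa_support; first exact: openT.
  by exists (set_val v); split=> //; exact: set_valP.
pose S i := \sum_j `|A i j|.
have S_ge0 i : 0 <= S i by exact: sumr_ge0.
(* Chosen so that [eps * (1 + S i) <= w i / V] for all [i]. The summand 1 keeps the denominator
   positive, and the default 1 keeps [eps] positive when [Nv] is 0. *)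
pose eps := \big[Order.min/1]_(i < Nv) (w i / V / (1 + S i)).
have eps_gt0 : 0 < eps.
  apply/bigmin_gtP; split=> // i _.
  by rewrite !divr_gt0 ?(V_gt0 (y i)) ?ltr_wpDr.
exists (fun i => w i / V - eps * \sum_j A i j), (fun=> eps); split=> //.
- move=> i; rewrite subr_ge0.
  apply: (@le_trans _ _ (eps * (1 + S i))).
    apply: ler_wpM2l; first exact: ltW.
    by rewrite ler_wpDl// ler_sum// => j _; exact: ler_norm.
  rewrite -ler_pdivlMr ?ltr_wpDr//; exact: bigmin_le_cond.
move=> f Pf; rewrite averageE//.
(* Expanding each [f (x j)] over the [y i] gives back exactly the amount [eps * \sum_j A i j]
   subtracted from [w i / V]. *)
under [X in _ + X]eq_bigr do rewrite fxE// mulr_sumr.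
rewrite exchange_big -big_split /=; apply: eq_bigr => i _.
under [X in _ + X]eq_bigr do rewrite mulrA.
by rewrite -mulr_suml -mulr_sumr -mulrDl subrK.
Qed.
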